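(* Let $\mathbf{k}$ be an algebraically closed field of characteristic $0$ and $A$ a finite-dimensional associative $\mathbf{k}$-algebra containing a nonzero central element $\nu$ such that $(\nu-r)^sA=0$ and $(\nu-r)^{s-1}A\neq0$ for some $r\in\mathbf{k}$ and $s\in\mathbb{Z}_{>0}$. Let $\mathcal{K}=\{a\in A\mid(\nu-r)a=0\}$. Let $W$ be a finitely generated projective right $A$-module and $\phi$ a symmetric linear function on $A$. Then for all $\alpha\in\mathrm{End}_A(W)$, $$\phi_{W}(\alpha\circ(\nu-r))=\phi'_{W/W\mathcal{K}}(\widehat{\alpha}),$$ where $\nu-r$ is identified with the element $w\mapsto w(\nu-r)$ of $\mathrm{End}_A(W)$, and $\phi'$, $\widehat\alpha$, $\phi_W$, $\phi'_{W/W\mathcal{K}}$ are as defined in the context.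
   Context: A linear function $\phi:A\to\mathbf{k}$ is symmetric if $\phi(ab)=\phi(ba)$ for all $a,b\in A$. For any finite-dimensional $\mathbf{k}$-algebra $B$, a finitely generated projective right $B$-module $V$ and a symmetric linear function $\psi$ on $B$, choose a $B$-coordinate system of $V$, i.e. $\{u_i\}_{i=1}^n\subset V$ and $\{\alpha_i\}_{i=1}^n\subset\mathrm{Hom}_B(V,B)$ with $v=\sum_i u_i\alpha_i(v)$ for all $v\in V$, and define $\psi_V:\mathrm{End}_B(V)\to\mathbf{k}$ by $\psi_V(\beta)=\psi\bigl(\sum_{i=1}^n\alpha_i(\beta(u_i))\bigr)$; this is independent of the choice of coordinate system. $\mathcal{K}$ is a two-sided ideal of $A$. $W/W\mathcal{K}$ is a right $A/\mathcal{K}$-module, which is finitely generated projective. For $\alpha\in\mathrm{End}_A(W)$, $\widehat\alpha\in\mathrm{End}_{A/\mathcal{K}}(W/W\mathcal{K})$ is defined by $\widehat\alpha(\overline{w})=\overline{\alpha(w)}$. The function $\phi'$ on $A/\mathcal{K}$ defined by $\phi'(\overline a)=\phi((\nu-r)a)$ is a well-defined symmetric linear function. *)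

(* Defs.v *)
(* A right B-module is an [lmodType] over the converse ring B^c, so that
   [b *: v] reads v.b; in particular B as a right module over itself is
   [(B^c)^o]. Rings are [pzRingType]s because A / K may be the zero ring. *)
From HB Require Import structures.
From mathcomp Require Import all_boot all_order all_algebra all_field.
From mathcomp Require Import boolp.

Set Implicit Arguments.
Unset Strict Implicit.
Unset Printing Implicit Defensive.

Import GRing.Theory.
Local Open Scope ring_scope.
Local Open Scope quotient_scope.

Definition finitely_generated (R : pzRingType) (V : lmodType R) : Prop :=
  exists (n : nat) (u : 'I_n -> V),
    forall v : V, exists c : 'I_n -> R, v = \sum_i c i *: u i.

Definition projective (R : pzRingType) (V : lmodType R) : Prop :=
  forall (M N : lmodType R) (p : {linear M -> N}) (f : {linear V -> N}),
    (forall y : N, exists x : M, p x = y) ->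
    exists g : {linear V -> M}, forall v : V, p (g v) = f v.

Definition fg_projective (R : pzRingType) (V : lmodType R) : Prop :=
  finitely_generated V /\ projective V.

Section TraceFunctions.
Variable B : pzRingType.

Record coordinate_system (V : lmodType B^c) := CoordinateSystem {
  coord_size : nat;
  coord_vec : 'I_coord_size -> V;
  coord_form : 'I_coord_size -> {linear V -> (B^c)^o};
  coord_sysP : forall v : V, v = \sum_i (coord_form i v : B^c) *: coord_vec i
}.
Arguments coord_vec {V} c i : rename.
Arguments coord_form {V} c i : rename.
Arguments coord_sysP {V} c v : rename.

Variable V : lmodType B^c.

Section LinearCombination.
Variables (M : lmodType B^c) (n : nat) (al : 'I_n -> {linear V -> (B^c)^o}).
Variable m : 'I_n -> M.

Definition lincomb (v : V) : M := \sum_i (al i v : B^c) *: m i.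

Lemma lincomb_is_linear : linear lincomb.
Proof.
move=> a x y; rewrite /lincomb scaler_sumr -big_split /=.
by apply: eq_bigr => i _; rewrite linearP scalerDl scalerA.
Qed.
HB.instance Definition _ := GRing.isLinear.Build B^c V M *:%R lincomb
  lincomb_is_linear.
End LinearCombination.

Lemma coordinate_system_fg_projective : coordinate_system V -> fg_projective V.
Proof.
case=> n u al uP; split; first by exists n, u => v; exists (al^~ v); exact: uP.
move=> M N p f p_surj; have [m mP] := choice (fun i => p_surj (f (u i))).
exists (lincomb al m) => v; rewrite [v in RHS]uP !linear_sum.
by apply: eq_bigr => i _; rewrite !linearZ /= mP.
Qed.

Lemma fg_projective_coordinate_system :
  fg_projective V -> exists _ : coordinate_system V, True.
Proof.
move=> [[n [u uP]] V_proj].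
pose pr i (x : {ffun 'I_n -> (B^c)^o}) := x i.
have pr_lin i : linear (pr i) by move=> a x y; rewrite /pr !ffunE.
pose prL i : {linear {ffun 'I_n -> (B^c)^o} -> (B^c)^o} :=
  HB.pack (pr i) (GRing.isLinear.Build _ _ _ _ (pr i) (pr_lin i)).
pose q (x : {ffun 'I_n -> (B^c)^o}) : V := \sum_i (x i : B^c) *: u i.
have q_lin : linear q.
  move=> a x y; rewrite /q scaler_sumr -big_split /=.
  by apply: eq_bigr => i _; rewrite !ffunE scalerDl scalerA.
pose qL : {linear {ffun 'I_n -> (B^c)^o} -> V} :=
  HB.pack q (GRing.isLinear.Build _ _ _ _ q q_lin).
have q_surj v : exists x, qL x = v.
  have [c ->] := uP v; exists [ffun i => c i].
  by apply: eq_bigr => i _; rewrite ffunE.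
have [g gP] := V_proj _ _ qL idfun q_surj.
by exists (@CoordinateSystem V n u (fun i => prL i \o g)
  (fun v => esym (gP v))).
Qed.

Definition chosen_coordinate_system (V_fgp : fg_projective V) :
    coordinate_system V :=
  sval (cid (fg_projective_coordinate_system V_fgp)).

Variable (k : zmodType).

Definition trace_with (psi : B -> k) (c : coordinate_system V) (beta : V -> V) :
    k :=
  psi (\sum_i (coord_form c i (beta (coord_vec c i)) : B)).

(* psi_V; it does not depend on the choice, see [trace_function_indep]. *)
Definition trace_function (psi : B -> k) (V_fgp : fg_projective V)
    (beta : {linear V -> V}) : k :=
  trace_with psi (chosen_coordinate_system V_fgp) beta.

Definition symmetric_function (psi : B -> k) : Prop :=
  forall a b : B, psi (a * b) = psi (b * a).

Lemma trace_function_indep (psi : {additive B -> k})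
    (V_fgp : fg_projective V) (c : coordinate_system V)
    (beta : {linear V -> V}) :
  symmetric_function psi -> trace_function psi V_fgp beta = trace_with psi c beta.
Proof.
move=> psiC; rewrite /trace_function; set d := chosen_coordinate_system _.
have expand (e f : coordinate_system V) (h : {linear V -> V}) i :
  coord_form e i (h (coord_vec e i))
    = \sum_j (coord_form f j (coord_vec e i) : B^c)
        *: coord_form e i (h (coord_vec f j)).
  rewrite {1}(coord_sysP f (coord_vec e i)) !linear_sum.
  by apply: eq_bigr => j _; rewrite !linearZ.
rewrite /trace_with !raddf_sum.
under eq_bigr => i _ do rewrite (expand d c) raddf_sum.
rewrite exchange_big /=; apply: eq_bigr => j _; rewrite -raddf_sum.
rewrite [in RHS](coord_sysP d (beta (coord_vec c j))) linear_sum !raddf_sum.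
by apply: eq_bigr => i _; rewrite linearZ psiC.
Qed.
End TraceFunctions.
Arguments coord_vec {B V} c i : rename.
Arguments coord_form {B V} c i : rename.
Arguments coord_sysP {B V} c v : rename.
Arguments CoordinateSystem {B V coord_size} coord_vec coord_form coord_sysP.

HB.mixin Record isTwoSidedIdeal (R : pzRingType) (S : R -> bool) := {
  ideal_mull_subproof : forall a x, x \in (S : {pred R}) -> a * x \in (S : {pred R});
  ideal_mulr_subproof : forall a x, x \in (S : {pred R}) -> x * a \in (S : {pred R})
}.

(* Not necessarily proper, unlike [idealr] of [ring_quotient]. *)
#[short(type="twoSidedIdeal")]
HB.structure Definition TwoSidedIdeal (R : pzRingType) :=
  {S of GRing.ZmodClosed R S & isTwoSidedIdeal R S}.

Section Ideals.
Variables (R : pzRingType) (I : twoSidedIdeal R).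

Lemma ideal_mull a x : x \in I -> a * x \in I.
Proof. exact: ideal_mull_subproof. Qed.

Lemma ideal_mulr a x : x \in I -> x * a \in I.
Proof. exact: ideal_mulr_subproof. Qed.

Definition ring_quot : Type := Quotient.quot I.
HB.instance Definition _ := EqQuotient.on ring_quot.
HB.instance Definition _ := GRing.Zmodule.on ring_quot.

Definition rproj (a : R) : ring_quot := \pi_(Quotient.quot I) a.
Definition rrepr (x : ring_quot) : R := repr (x : Quotient.quot I).

Lemma rreprK : cancel rrepr rproj.
Proof. exact: reprK. Qed.

Lemma rprojP a b : rproj a = rproj b <-> a - b \in I.
Proof. by rewrite Quotient.idealrBE; split=> /eqP. Qed.

Lemma rrepr_proj a : rrepr (rproj a) - a \in I.
Proof. by apply/rprojP; rewrite rreprK. Qed.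

Lemma rproj_is_zmod_morphism : zmod_morphism rproj.
Proof. by move=> a b; rewrite /rproj !piE. Qed.
HB.instance Definition _ := GRing.isZmodMorphism.Build R ring_quot rproj
  rproj_is_zmod_morphism.

Definition rq_mul (x y : ring_quot) : ring_quot := rproj (rrepr x * rrepr y).

Lemma rproj_mul a b : rq_mul (rproj a) (rproj b) = rproj (a * b).
Proof.
apply/rprojP; set a' := rrepr _; set b' := rrepr _.
rewrite -[_ * b'](addrNK (a * b')) -mulrBl -addrA -mulrBr.
by apply: rpredD; [apply: ideal_mulr | apply: ideal_mull]; apply: rrepr_proj.
Qed.

Lemma rq_mulA : associative rq_mul.
Proof.
by move=> x y z; rewrite -(rreprK x) -(rreprK y) -(rreprK z) !rproj_mul mulrA.
Qed.
Lemma rq_mul1l : left_id (rproj 1) rq_mul.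
Proof. by move=> x; rewrite -(rreprK x) rproj_mul mul1r. Qed.
Lemma rq_mul1r : right_id (rproj 1) rq_mul.
Proof. by move=> x; rewrite -(rreprK x) rproj_mul mulr1. Qed.
Lemma rq_mulDl : left_distributive rq_mul +%R.
Proof.
move=> x y z; rewrite -(rreprK x) -(rreprK y) -(rreprK z).
by rewrite -raddfD !rproj_mul mulrDl raddfD.
Qed.
Lemma rq_mulDr : right_distributive rq_mul +%R.
Proof.
move=> x y z; rewrite -(rreprK x) -(rreprK y) -(rreprK z).
by rewrite -raddfD !rproj_mul mulrDr raddfD.
Qed.
HB.instance Definition _ := GRing.Zmodule_isPzRing.Build ring_quot
  rq_mulA rq_mul1l rq_mul1r rq_mulDl rq_mulDr.

Lemma rprojM a b : rproj (a * b) = rproj a * rproj b.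
Proof. by rewrite -rproj_mul. Qed.

End Ideals.

Section AlgebraQuotient.
Variables (k : fieldType) (A : falgType k) (I : twoSidedIdeal A).

Definition rq_scale (c : k) (x : ring_quot I) : ring_quot I :=
  rproj I (c *: rrepr x).

Lemma rproj_scale c a : rq_scale c (rproj I a) = rproj I (c *: a).
Proof.
by apply/rprojP; rewrite -scalerBr -mulr_algl ideal_mull // rrepr_proj.
Qed.

Lemma rq_scaleA a b v : rq_scale a (rq_scale b v) = rq_scale (a * b) v.
Proof. by rewrite -(rreprK v) !rproj_scale scalerA. Qed.
Lemma rq_scale1 : left_id 1 rq_scale.
Proof. by move=> v; rewrite -(rreprK v) rproj_scale scale1r. Qed.
Lemma rq_scaleDr : right_distributive rq_scale +%R.
Proof.
move=> a u v; rewrite -(rreprK u) -(rreprK v).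
by rewrite -raddfD !rproj_scale scalerDr raddfD.
Qed.
Lemma rq_scaleDl v : {morph rq_scale^~ v : a b / a + b}.
Proof. by move=> a b; rewrite -(rreprK v) !rproj_scale scalerDl raddfD. Qed.
HB.instance Definition _ := GRing.Zmodule_isLmodule.Build k (ring_quot I)
  rq_scaleA rq_scale1 rq_scaleDr rq_scaleDl.

Lemma rprojZ c a : rproj I (c *: a) = c *: rproj I a.
Proof. by rewrite -rproj_scale. Qed.

Lemma rq_scaleAl c (x y : ring_quot I) : c *: (x * y) = (c *: x) * y.
Proof.
rewrite -(rreprK x) -(rreprK y).
by rewrite -rprojM -!rprojZ -rprojM scalerAl.
Qed.

Lemma rq_scaleAr c (x y : ring_quot I) : c *: (x * y) = x * (c *: y).
Proof.
rewrite -(rreprK x) -(rreprK y).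
by rewrite -rprojM -!rprojZ -rprojM scalerAr.
Qed.
End AlgebraQuotient.

Section ModuleQuotient.
Variables (R : pzRingType) (W : lmodType R^c) (I : twoSidedIdeal R).

(* W I : the finite sums of products w.a with w in W and a in I *)
Definition mod_ideal : {pred W} := fun v =>
  `[< exists (n : nat) (w : 'I_n -> W) (a : 'I_n -> R),
        (forall i, a i \in I) /\ v = \sum_i (a i : R^c) *: w i >].

Lemma mod_ideal_scale (a : R) (w : W) : a \in I -> (a : R^c) *: w \in mod_ideal.
Proof.
move=> aI; apply/asboolP; exists 1%N, (fun=> w), (fun=> a).
by split=> //; rewrite big_ord1.
Qed.

Lemma mod_ideal_zmod_closed : zmod_closed mod_ideal.
Proof.
split; first by apply/asboolP; exists 0%N, (fun=> 0), (fun=> 0);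
  split=> [[]//|]; rewrite big_ord0.
move=> _ _ /asboolP[m [w [a [aI ->]]]] /asboolP[n [v [b [bI ->]]]].
apply/asboolP; exists (m + n)%N,
  (fun i => match split i with inl j => w j | inr j => v j end),
  (fun i => match split i with inl j => a j | inr j => - b j end).
split=> [i|]; first by case: (split i) => j; rewrite ?rpredN.
rewrite big_split_ord /= -sumrN; congr (_ + _); apply: eq_bigr => i _.
  by rewrite (unsplitK (inl i)).
by rewrite (unsplitK (inr i)) scaleNr.
Qed.
HB.instance Definition _ := GRing.isZmodClosed.Build W mod_ideal
  mod_ideal_zmod_closed.

Lemma mod_idealZ (a : R^c) (v : W) : v \in mod_ideal -> a *: v \in mod_ideal.
Proof.
move=> /asboolP[n [w [b [bI ->]]]]; rewrite scaler_sumr rpred_sum // => i _.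
by rewrite scalerA mod_ideal_scale // ideal_mulr.
Qed.

Definition mod_quot : Type := Quotient.quot mod_ideal.
HB.instance Definition _ := EqQuotient.on mod_quot.
HB.instance Definition _ := GRing.Zmodule.on mod_quot.

Definition mproj (w : W) : mod_quot := \pi_(Quotient.quot mod_ideal) w.
Definition mrepr (x : mod_quot) : W := repr (x : Quotient.quot mod_ideal).

Lemma mreprK : cancel mrepr mproj.
Proof. exact: reprK. Qed.

Lemma mprojP v w : mproj v = mproj w <-> v - w \in mod_ideal.
Proof. by rewrite Quotient.idealrBE; split=> /eqP. Qed.

Lemma mrepr_proj w : mrepr (mproj w) - w \in mod_ideal.
Proof. by apply/mprojP; rewrite mreprK. Qed.

Lemma mproj_is_zmod_morphism : zmod_morphism mproj.
Proof. by move=> a b; rewrite /mproj !piE. Qed.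
HB.instance Definition _ := GRing.isZmodMorphism.Build W mod_quot mproj
  mproj_is_zmod_morphism.

Definition mq_scale (x : (ring_quot I)^c) (v : mod_quot) : mod_quot :=
  mproj ((rrepr x : R^c) *: mrepr v).

Lemma mproj_scale (a : R) w :
  mq_scale (rproj I a) (mproj w) = mproj ((a : R^c) *: w).
Proof.
apply/mprojP; set a' := rrepr _; set w' := mrepr _.
rewrite -[(a' : R^c) *: w'](addrNK ((a : R^c) *: w')) -scalerBl -addrA -scalerBr.
by apply: rpredD; [apply/mod_ideal_scale/rrepr_proj | apply/mod_idealZ/mrepr_proj].
Qed.

Lemma mq_scaleA a b v : mq_scale a (mq_scale b v) = mq_scale (a * b) v.
Proof.
rewrite -(mreprK v) -(rreprK a) -(rreprK b).
move: (rrepr a) (rrepr b) (mrepr v) => {}a {}b w.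
have -> : (rproj I a : (ring_quot I)^c) * rproj I b = rproj I (b * a).
  by rewrite rprojM.
by rewrite !mproj_scale scalerA.
Qed.
Lemma mq_scale1 : left_id 1 mq_scale.
Proof.
by move=> v; rewrite -(mreprK v) -[1]/(rproj I 1) mproj_scale scale1r.
Qed.
Lemma mq_scaleDr : right_distributive mq_scale +%R.
Proof.
move=> a u v; rewrite -(mreprK u) -(mreprK v) -(rreprK a).
by rewrite -raddfD !mproj_scale scalerDr raddfD.
Qed.
Lemma mq_scaleDl v : {morph mq_scale^~ v : a b / a + b}.
Proof.
move=> a b; rewrite -(mreprK v) -(rreprK a) -(rreprK b).
move: (rrepr a) (rrepr b) (mrepr v) => {}a {}b w.
have -> : (rproj I a : (ring_quot I)^c) + rproj I b = rproj I (a + b).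
  by rewrite raddfD.
by rewrite !mproj_scale scalerDl raddfD.
Qed.
HB.instance Definition _ := GRing.Zmodule_isLmodule.Build (ring_quot I)^c mod_quot
  mq_scaleA mq_scale1 mq_scaleDr mq_scaleDl.

Lemma mprojZ (a : R) w :
  mproj ((a : R^c) *: w) = (rproj I a : (ring_quot I)^c) *: mproj w.
Proof. by rewrite -mproj_scale. Qed.

Section InducedEnd.
Variable alpha : {linear W -> W}.

Definition hat (x : mod_quot) : mod_quot := mproj (alpha (mrepr x)).

Lemma hat_proj w : hat (mproj w) = mproj (alpha w).
Proof.
apply/mprojP; rewrite -raddfB /=.
have /asboolP[n [v [a [aI ->]]]] := mrepr_proj w.
rewrite linear_sum rpred_sum // => i _.
by rewrite linearZ mod_ideal_scale.
Qed.

Lemma hat_is_linear : linear hat.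
Proof.
move=> a x y; rewrite -(mreprK x) -(mreprK y) -(rreprK a).
by rewrite -mprojZ -raddfD !hat_proj -mprojZ -raddfD linearP.
Qed.
HB.instance Definition _ := GRing.isLinear.Build (ring_quot I)^c mod_quot mod_quot
  *:%R hat hat_is_linear.
End InducedEnd.

Section InducedForm.
Variable al : {linear W -> (R^c)^o}.

Definition hat_form (x : mod_quot) : ((ring_quot I)^c)^o :=
  rproj I (al (mrepr x)).

Lemma hat_form_proj w : hat_form (mproj w) = rproj I (al w).
Proof.
apply/rprojP; rewrite -[_ - _]/(al (mrepr (mproj w)) - al w) -raddfB /=.
have /asboolP[n [v [a [aI ->]]]] := mrepr_proj w.
rewrite linear_sum; apply: (@rpred_sum R I) => i _.
by rewrite linearZ /=; exact: (ideal_mull (al (v i) : R) (aI i)).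
Qed.

Lemma hat_form_is_linear : linear hat_form.
Proof.
move=> a x y; rewrite -(mreprK x) -(mreprK y) -(rreprK a).
rewrite -mprojZ -raddfD !hat_form_proj linearP.
rewrite -[RHS]/(rproj I (al (mrepr x)) * rproj I (rrepr a)
                + rproj I (al (mrepr y))).
by rewrite -rprojM -raddfD.
Qed.
HB.instance Definition _ := GRing.isLinear.Build (ring_quot I)^c mod_quot
  ((ring_quot I)^c)^o *:%R hat_form hat_form_is_linear.
End InducedForm.

Lemma quot_coord_sysP (c : coordinate_system W) (v : mod_quot) :
  v = \sum_i (hat_form (coord_form c i) v : (ring_quot I)^c)
        *: mproj (coord_vec c i).
Proof.
rewrite -[LHS]mreprK [mrepr v in LHS](coord_sysP c) raddf_sum.
by apply: eq_bigr => i _; rewrite /= mprojZ.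
Qed.

Definition quot_coordinate_system (c : coordinate_system W) :
    coordinate_system mod_quot :=
  CoordinateSystem (fun i => mproj (coord_vec c i))
    (fun i => hat_form (coord_form c i)) (quot_coord_sysP c).

Lemma quot_fg_projective : fg_projective W -> fg_projective mod_quot.
Proof.
move=> /fg_projective_coordinate_system[c _].
exact/coordinate_system_fg_projective/quot_coordinate_system.
Qed.

End ModuleQuotient.
Arguments hat {R W} I alpha x.
Arguments quot_fg_projective {R W} I.

Definition central (R : pzRingType) (z : R) : Prop := forall a, z * a = a * z.

Section CentralElement.
Variables (k : fieldType) (A : falgType k) (z : A) (zC : central z).

(* K; the centrality proof is an argument because K is an ideal only then. *)
Definition annihilator (_ : central z) : {pred A} := fun a => z * a == 0.

Let annE a : (a \in annihilator zC) = (z * a == 0).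
Proof. by []. Qed.

Lemma annihilator_zmod_closed : zmod_closed (annihilator zC).
Proof.
split=> [|a b]; rewrite !annE ?mulr0 // => /eqP za /eqP zb.
by rewrite mulrBr za zb subrr.
Qed.
HB.instance Definition _ := GRing.isZmodClosed.Build A (annihilator zC)
  annihilator_zmod_closed.

Lemma annihilator_mull a x : x \in annihilator zC -> a * x \in annihilator zC.
Proof. by rewrite !annE => /eqP zx; rewrite mulrA zC -mulrA zx mulr0. Qed.
Lemma annihilator_mulr a x : x \in annihilator zC -> x * a \in annihilator zC.
Proof. by rewrite !annE => /eqP zx; rewrite mulrA zx mul0r. Qed.
HB.instance Definition _ := isTwoSidedIdeal.Build A (annihilator zC)
  annihilator_mull annihilator_mulr.

Section InducedFunction.
Variable phi : {scalar A}.

(* Used with z = nu - r; characterised by [phi_prime_proj]. *)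
Definition phi_prime (x : ring_quot (annihilator zC)) : k := phi (z * rrepr x).

Lemma phi_prime_proj a : phi_prime (rproj (annihilator zC) a) = phi (z * a).
Proof.
apply/eqP; rewrite -subr_eq0 -raddfB /= -mulrBr.
by have := rrepr_proj (annihilator zC) a; rewrite annE => /eqP->; rewrite raddf0.
Qed.

Lemma phi_prime_is_scalar : scalar phi_prime.
Proof.
move=> c x y; rewrite -(rreprK x) -(rreprK y) -rprojZ -raddfD !phi_prime_proj.
by rewrite mulrDr -scalerAr linearP.
Qed.
HB.instance Definition _ := GRing.isLinear.Build k (ring_quot (annihilator zC)) k
  *%R phi_prime phi_prime_is_scalar.

Lemma phi_prime_symmetric :
  symmetric_function phi -> symmetric_function phi_prime.
Proof.
move=> phiC x y; rewrite -(rreprK x) -(rreprK y) -!rprojM !phi_prime_proj.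
move: (rrepr x) (rrepr y) => a b.
by rewrite [z * (a * b)]mulrA phiC [b * (z * a)]mulrA -zC [z * (b * a)]mulrA.
Qed.
End InducedFunction.

Variable W : lmodType A^c.

Definition central_act (_ : central z) (w : W) : W := (z : A^c) *: w.

Lemma central_act_is_linear : linear (central_act zC).
Proof.
move=> a v w; rewrite /central_act scalerDr !scalerA; congr (_ *: _ + _).
exact/esym/zC.
Qed.
HB.instance Definition _ := GRing.isLinear.Build A^c W W *:%R (central_act zC)
  central_act_is_linear.

End CentralElement.
Arguments annihilator {k A z} zC.
Arguments phi_prime {k A z} zC phi x.
Arguments central_act {k A z} {W} zC w.

Lemma central_sub_scalar (k : fieldType) (A : falgType k) (nu : A) (r : k) :
  central nu -> central (nu - r%:A).
Proof.
by move=> nuC a; rewrite mulrBl mulrBr nuC mulr_algl mulr_algr.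
Qed.

(* Main.v *)
(* If (u_i, a_i) is a coordinate system of W, its reduction modulo K is one of
   W/WK, and a_i (alpha (u_i z)) = a_i (alpha u_i) z for z = nu - r; so both
   sides equal phi (z * \sum_i a_i (alpha u_i)). *)
Require Import Defs.
From mathcomp Require Import all_boot all_order all_algebra all_field.
Import GRing.Theory.
Local Open Scope ring_scope.

Lemma trace_function_central_act (k : fieldType) (A : falgType k)
    (z : A) (zC : central z) (W : lmodType A^c) (W_fgp : fg_projective W)
    (phi : {scalar A}) (phiC : symmetric_function phi)
    (alpha : {linear W -> W}) :
  trace_function phi W_fgp (alpha \o central_act zC) =
  trace_function (phi_prime zC phi) (quot_fg_projective (annihilator zC) W_fgp)
    (hat (annihilator zC) alpha).
Proof.
set c := chosen_coordinate_system W_fgp.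
(* The system chosen for [W/WK] need not be the reduction of [c]; symmetry of [phi_prime] allows the
   exchange. *)
rewrite (trace_function_indep (quot_fg_projective _ W_fgp)
  (quot_coordinate_system (annihilator zC) c) (hat _ alpha)
  (phi_prime_symmetric phiC)).
rewrite /trace_function -/c /trace_with /=.
under [in RHS]eq_bigr => i _ do rewrite hat_proj hat_form_proj.
(* The sum of classes is the class of a sum in [A], where [phi_prime] can be evaluated. *)
rewrite -raddf_sum phi_prime_proj mulr_sumr.
congr (phi _); apply: eq_bigr => i _.
(* Scaling in [(A^c)^o] is right multiplication, so linearity puts [z] on the right; centrality
   moves it to the left. *)
by rewrite /central_act !linearZ; exact/esym/zC.
Qed.

Theorem proposition4p1
  (k : closedFieldType) (k_char0 : [pchar k] =i pred0)
  (A : falgType k) (nu : A) (nu_neq0 : nu != 0) (nuC : central nu)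
  (r : k) (s : nat) (s_gt0 : (0 < s)%N)
  (nil_s : forall a : A, (nu - r%:A) ^+ s * a = 0)
  (nnil_s : exists a : A, (nu - r%:A) ^+ s.-1 * a != 0)
  (W : lmodType A^c) (W_fgp : fg_projective W)
  (phi : {scalar A}) (phiC : symmetric_function phi)
  (alpha : {linear W -> W}) :
  let zC := central_sub_scalar r nuC in
  trace_function phi W_fgp (alpha \o central_act zC) =
  trace_function (phi_prime zC phi) (quot_fg_projective (annihilator zC) W_fgp)
    (hat (annihilator zC) alpha).
Proof. exact: trace_function_central_act. Qed.
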